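(* Let $R$ be a valuation ring of height one. All ground sets below are finite. (a) If $M$ is a matroid over $R$ on ground set $E$ and $a\in E$, then $$P(M\setminus a)=\pi_a(P(M)\cap\{x_a=0\})\quad\text{and}\quad P(M/a)=\pi_a(P(M)\cap\{x_a=1\}),$$ where $\pi_a:\mathbb R^E\times\mathbb R^2\to\mathbb R^{E\setminus a}\times\mathbb R^2$ omits the $x_a$ coordinate. (b) If $M$ is a matroid over $R$ on ground set $E$ with $|E|=n$, identified with $[n]$, then $P(M^* )=s(P(M))$, where $s:\mathbb R^E\times\mathbb R^2\to\mathbb R^E\times\mathbb R^2$ is the affine map $$s(x_1,\dots,x_n,i,y)=(1-x_1,\dots,1-x_n,\ x_1+\cdots+x_n-r+i,\ y)$$ and $r$ is the generic rank of $M$. (c) If $M_1$ and $M_2$ are matroids over $R$ on disjoint ground sets $E_1$ and $E_2$, then $$P(M_1\oplus M_2)=\iota_1(P(M_1))+\iota_2(P(M_2))$$ (Minkowski sum), where $\iota_j:\mathbb R^{E_j}\times\mathbb R^2\to\mathbb R^{E_1\cup E_2}\times\mathbb R^2$ are the canonical inclusions, both being the identity on the second factor.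
   Context: $R$ is a valuation ring of height one, with $\operatorname{val}:R\to\mathbb R\cup\{\infty\}$. A (finitely presented) matroid over $R$ on $E$ is a function $M$ assigning to each $A\subseteq E$ a finitely presented $R$-module $M(A)$ (only isomorphism types matter) such that for all $A\subseteq E$ and $b,c\in E$ there are $x,y\in M(A)$ with $M(A\cup\{b\})\cong M(A)/(x)$, $M(A\cup\{c\})\cong M(A)/(y)$, $M(A\cup\{b,c\})\cong M(A)/(x,y)$. For a finitely presented module $N\cong\bigoplus_jR/(x_j)$, $\operatorname{length}(N)=\sum_j\operatorname{val}(x_j)$; for $i\ge0$, $t_i(N)=\min_{x_1,\dots,x_i\in N}\operatorname{length}(N/\langle x_1,\dots,x_i\rangle)$; and $t_i(A)=t_i(M(A))$. The family $(t_i(N))_i$ determines $N$ up to isomorphism. With $e_A=\sum_{a\in A}e_a\in\mathbb R^E$, $$P(M)=\operatorname{conv}\{(e_A,i,t_i(A)):A\subseteq E,\ i\in\mathbb Z_{\ge0}\}+\operatorname{cone}\{(\underline0,0,1)\}\subseteq\mathbb R^E\times\mathbb R^2,$$ omitting points with $t_i(A)=\infty$. The standard coordinates on $\mathbb R^E$ are $\{x_a:a\in E\}$. Operations: $(M\setminus a)(A)=M(A)$ and $(M/a)(A)=M(A\cup\{a\})$ for $A\subseteq E\setminus\{a\}$; $(M_1\oplus M_2)(A_1\cup A_2)=M_1(A_1)\oplus M_2(A_2)$ for $A_j\subseteq E_j$. The generic rank $r$ of $M$ is the rank of the free part of $M(\emptyset)$. The dual $M^*$ is the matroid over $R$ on $E$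 determined by $t_i(M(A))=t_{|A|-r+i}(M^*(E\setminus A))$ for all $A\subseteq E$ and all integers $i$, where $t_j=\infty$ for $j<0$. *)

(* Defs.v *)
From HB Require Import structures.
From mathcomp Require Import all_boot all_order all_algebra.
From mathcomp Require Import generic_quotient ring_quotient.
From mathcomp Require Import boolp classical_sets reals constructive_ereal ereal.

Set Implicit Arguments.
Unset Strict Implicit.
Unset Printing Implicit Defensive.

Import Order.TTheory GRing.Theory Num.Theory.

Local Open Scope classical_set_scope.
Local Open Scope ring_scope.

Section Modules.
Variable R : comNzRingType.
Implicit Types N : lmodType R.

Definition lspan N (s : seq N) : {pred N} :=
  fun v => `[< exists c : 'I_(size s) -> R, v = \sum_j c j *: s`_j >].

Lemma lspan_submod_closed N (s : seq N) : submod_closed (lspan s).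
Proof.
split.
  by apply/asboolP; exists (fun=> 0); rewrite big1// => j _; rewrite scale0r.
move=> a u v /asboolP[c ->] /asboolP[d ->]; apply/asboolP.
exists (fun j => a * c j + d j); rewrite scaler_sumr -big_split/=.
by apply: eq_bigr => j _; rewrite scalerDl scalerA.
Qed.

HB.instance Definition _ N (s : seq N) :=
  GRing.isSubmodClosed.Build R N (lspan s) (lspan_submod_closed s).

(* [lquot s] is the quotient module N / <s_0, ..., s_(k-1)>.  MathComp only
   provides the additive structure of such a quotient. *)
Definition lquot N (s : seq N) : Type := Quotient.quot (lspan s).

HB.instance Definition _ N (s : seq N) := GRing.Zmodule.on (lquot s).

Section Scale.
Variables (N : lmodType R) (s : seq N).
Local Open Scope quotient_scope.

Definition lquot_pi (v : N) : lquot s := \pi_(Quotient.quot (lspan s)) v.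

Lemma lquot_piP (u v : N) : lquot_pi u = lquot_pi v <-> u - v \in lspan s.
Proof. by rewrite Quotient.idealrBE; split=> [E|/eqP]; first exact/eqP. Qed.

Lemma lquot_reprK (q : lquot s) : lquot_pi (repr q) = q.
Proof. exact: reprK. Qed.

Lemma lquot_piD (u v : N) : lquot_pi (u + v) = lquot_pi u + lquot_pi v.
Proof. exact: (raddfD (\pi_(Quotient.quot (lspan s)))). Qed.

Definition lquot_scale (a : R) (q : lquot s) : lquot s := lquot_pi (a *: repr q).

Lemma lquot_scale_pi a v : lquot_scale a (lquot_pi v) = lquot_pi (a *: v).
Proof. by apply/lquot_piP; rewrite -scalerBr rpredZ//; apply/lquot_piP/reprK. Qed.

Fact lquot_scaleA a b q :
  lquot_scale a (lquot_scale b q) = lquot_scale (a * b) q.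
Proof. by rewrite -[q]lquot_reprK !lquot_scale_pi scalerA. Qed.

Fact lquot_scale1 : left_id 1 lquot_scale.
Proof. by move=> q; rewrite -[q]lquot_reprK lquot_scale_pi scale1r. Qed.

Fact lquot_scaleDr : right_distributive lquot_scale +%R.
Proof.
move=> a p q; rewrite -[p]lquot_reprK -[q]lquot_reprK -lquot_piD.
by rewrite !lquot_scale_pi -lquot_piD scalerDr.
Qed.

Fact lquot_scaleDl q : {morph lquot_scale^~ q : a b / a + b}.
Proof.
by move=> a b; rewrite -[q]lquot_reprK !lquot_scale_pi -lquot_piD scalerDl.
Qed.

HB.instance Definition _ := GRing.Zmodule_isLmodule.Build R (lquot s)
  lquot_scaleA lquot_scale1 lquot_scaleDr lquot_scaleDl.
End Scale.

Definition lmod_iso (N N' : lmodType R) : Prop :=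
  exists f : {linear N -> N'}, bijective f.

Definition finitely_presented N : Prop :=
  exists n (s : seq 'rV[R]_n), lmod_iso N (lquot s).

Definition torsion N : Prop :=
  forall v : N, exists2 a : R, a != 0 & a *: v = 0.

(* R/(x_1) (+) ... (+) R/(x_n), with R^0 for the empty sum *)
Fixpoint cyclic_sum (xs : seq R) : lmodType R :=
  if xs is x :: xs' then (lquot [:: (x : R^o)] * cyclic_sum xs')%type
  else 'rV[R]_0.

(* The rank r of the free part: N = R^r (+) (a torsion module).  Over a domain
   there is at most one such r, and at least one when the domain is a valuation
   ring and N is finitely presented. *)
Definition free_rank N : nat :=
  xget 0%N [set r | exists T : lmodType R,
                      torsion T /\ lmod_iso N ('rV[R]_r * T)%type].

End Modules.

Notation "N ≅ N'" := (lmod_iso N N') (at level 70, no associativity).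

(* A valuation ring is a domain in which divisibility is total; height one means
   that its value group is isomorphic to a nonzero subgroup of the real numbers.
   [val] is the valuation restricted to R, so that it is nonnegative. *)
Record valuation_ring_height_one (K : realType) (R : idomainType)
    (val : R -> \bar K) : Prop := ValuationRingHeightOne {
  divides_total : forall x y : R, (exists z, y = z * x) \/ (exists z, x = z * y);
  val_ge0 : forall x, (0 <= val x)%E;
  val_eq_pinfty : forall x, val x = +oo%E <-> x = 0;
  val_mul : forall x y, val (x * y) = (val x + val y)%E;
  val_add : forall x y, (Order.min (val x) (val y) <= val (x + y)%R)%E;
  val_eq0 : forall x, val x = 0%E <-> x \is a GRing.unit;
  height_gt0 : exists2 x : R, x != 0 & x \isn't a GRing.unit
}.

Section Length.
Variables (K : realType) (R : idomainType) (val : R -> \bar K).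
Implicit Types N : lmodType R.

(* A finitely presented module over a valuation ring has a decomposition into
   cyclic modules, and the sum below does not depend on it; modules with no
   such decomposition get the junk value +oo. *)
Definition length N : \bar K :=
  xget +oo%E [set l | exists xs : seq R,
    N ≅ cyclic_sum xs /\ l = (\sum_(x <- xs) val x)%E].

(* The infimum is attained for finitely presented modules over a valuation ring
   of height one, so it is the minimum over all i-tuples of elements of N. *)
Definition t_inv N (i : nat) : \bar K :=
  ereal_inf [set length (lquot x) | x in [set: i.-tuple N]].

Definition t_invz N (i : int) : \bar K :=
  if i is Posz j then t_inv N j else +oo%E.

End Length.

Section Matroids.
Variable R : idomainType.

Definition matroid_over (E : finType) (M : {set E} -> lmodType R) : Prop :=
  (forall A, finitely_presented (M A)) /\
  (forall (A : {set E}) (b c : E), exists x y : M A,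
    [/\ M (A :|: [set b]) ≅ lquot [:: x],
        M (A :|: [set c]) ≅ lquot [:: y] &
        M (A :|: [set b; c]) ≅ lquot [:: x; y]]).

Definition generic_rank (E : finType) (M : {set E} -> lmodType R) : nat :=
  free_rank (M finset.set0).

(* The ground set of a minor is the subtype E \ a. *)
Definition deletion (E : finType) (M : {set E} -> lmodType R) (a : E)
    (A : {set {x : E | x != a}}) : lmodType R :=
  M (\val @: A)%SET.

Definition contraction (E : finType) (M : {set E} -> lmodType R) (a : E)
    (A : {set {x : E | x != a}}) : lmodType R :=
  M ((\val @: A) :|: [set a])%SET.

(* The disjoint union of the ground sets is the sum type, so a subset of it is
   determined by its traces on the two summands. *)
Definition direct_sum (E1 E2 : finType) (M1 : {set E1} -> lmodType R)
    (M2 : {set E2} -> lmodType R) (A : {set (E1 + E2)}) : lmodType R :=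
  (M1 (inl @^-1: A)%SET * M2 (inr @^-1: A)%SET)%type.

(* The t-invariants determine a finitely presented module up to isomorphism, so
   this determines the values of [Md] up to isomorphism. *)
Definition is_dual (K : realType) (val : R -> \bar K) (E : finType)
    (M Md : {set E} -> lmodType R) : Prop :=
  matroid_over Md /\
  forall (A : {set E}) (i : int),
    t_invz val (M A) i =
    t_invz val (Md (~: A)%SET) (#|A|%:Z - (generic_rank M)%:Z + i).

End Matroids.

Arguments deletion {R E} M a A.
Arguments contraction {R E} M a A.

Section Polyhedra.
Variables (K : realType) (V : lmodType K).
Implicit Types X Y : set V.

Definition conv_hull X : set V :=
  [set p | exists n (c : 'I_n -> K) (v : 'I_n -> V),
    [/\ forall j, 0 <= c j, \sum_j c j = 1, forall j, X (v j) &
        p = \sum_j c j *: v j]].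

Definition conic_hull X : set V :=
  [set p | exists n (c : 'I_n -> K) (v : 'I_n -> V),
    [/\ forall j, 0 <= c j, forall j, X (v j) & p = \sum_j c j *: v j]].

Definition minkowski X Y : set V := [set x + y | x in X & y in Y].

End Polyhedra.

(* R^E x R^2 *)
Definition ambient (K : realType) (E : finType) : lmodType K :=
  ({ffun E -> K^o} * (K^o * K^o))%type.

Section Polytope.
Variable K : realType.

Definition indicator (E : finType) (A : {set E}) : {ffun E -> K^o} :=
  [ffun a => (a \in A)%:R].

Definition polyhedron (R : idomainType) (val : R -> \bar K) (E : finType)
    (M : {set E} -> lmodType R) : set (ambient K E) :=
  minkowski
    (conv_hull [set p : ambient K E | exists (A : {set E}) (i : nat) (y : K),
       t_inv val (M A) i = y%:E /\ p = (indicator A, (i%:R, y))])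
    (conic_hull [set ((0, (0, 1)) : ambient K E)]).

Definition omit_coord (E : finType) (a : E) (p : ambient K E) :
    ambient K {x : E | x != a} :=
  ([ffun x => p.1 (\val x)], p.2).

Definition dual_map (E : finType) (r : nat) (p : ambient K E) : ambient K E :=
  ([ffun a => 1 - p.1 a], (\sum_a p.1 a - r%:R + p.2.1, p.2.2)).

Definition incl1 (E1 E2 : finType) (p : ambient K E1) : ambient K (E1 + E2)%type :=
  ([ffun e => if e is inl a then p.1 a else 0], p.2).

Definition incl2 (E1 E2 : finType) (p : ambient K E2) : ambient K (E1 + E2)%type :=
  ([ffun e => if e is inr a then p.1 a else 0], p.2).

End Polytope.

Arguments incl1 {K E1} E2 p.
Arguments incl2 {K} E1 {E2} p.

(* Main.v *)
Require Import Defs.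
From HB Require Import structures.
From mathcomp Require Import all_boot all_order all_algebra.
From mathcomp Require Import perm zify ring.
From mathcomp Require Import boolp classical_sets reals constructive_ereal ereal.

Import Order.TTheory GRing.Theory Num.Theory.

Local Open Scope classical_set_scope.
Local Open Scope ring_scope.

(** The polyhedron of a matroid is the smallest convex set that contains the
points (e_A, i, t_i(A)) with t_i(A) finite and is stable under increasing the last coordinate
(lemma polyhedron_sub).  Every inclusion between polyhedra is therefore a
statement about these generators, once the other side is known to be convex
and upward closed.

For minors, the hyperplanes x_a = 0 and x_a = 1 support P(M), so a face is cut
out by the generators on it: those with a outside A, respectively in A.  These
are the generators of the deletion and of the contraction.  For the dual, the
affine map s matches the generators of P(M) one to one with those of the dual
polyhedron: this is the defining relation of the dual, since a generator on
either side has a finite t-invariant and hence a nonnegative index.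

For direct sums, the generators on the two sides correspond through
  t_k(N1 + N2) = min over i + j = k of t_i(N1) + t_j(N2)      (N1 + N2 direct),
which is the only place where modules matter.  The inequality <= holds because
length is additive on direct sums.  For >=, write N1 and N2 as sums of cyclic
modules R/(d_j), which is possible for every finitely presented module over a
valuation ring (lemma diag_pres_lquot).  If a quotient of the sum of the
R/(d_j) by k elements is isomorphic to the sum of the R/(e_l), then the d_j
outside some set S of at most k indices satisfy
  sum of val d_j  <=  sum of val e_l
(lemma diag_relations_val).  Splitting S along the two summands gives i and j,
because killing the generators indexed by S is itself an admissible quotient.
The case k = 0 also shows that length does not depend on the decomposition.

The inequality is a Fitting ideal argument: the product of the e_l is the
determinant of a square matrix of relations between two generating families.
This matrix factors through a diagonal matrix that carries the d_j, k entries
1 for the additional relations, and further entries 1.  Expanding the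
determinant of such a product over injective maps, every term contains all but
at most k of the d_j. *)

(** * Spans and quotient modules *)

Section Span.
Context {R : comNzRingType}.
Implicit Types N U : lmodType R.

(** Most linear maps below are built inside proofs; this turns a raw function
into a bundled map there. *)
Lemma linear_map_of {U N} {f : U -> N} :
  linear f -> exists g : {linear U -> N}, g =1 f.
Proof.
move=> lf; pose g : {linear U -> N} :=
  HB.pack f (GRing.isLinear.Build R U N *:%R f lf).
by exists g.
Qed.

Lemma mem_lspan {N} (s : seq N) v :
  v \in lspan s <-> exists c : 'I_(size s) -> R, v = \sum_j c j *: s`_j.
Proof. by split=> [/asboolP|h]; last exact/asboolP. Qed.

Lemma mem_lspan_nil {N} (v : N) : v \in lspan [::] <-> v = 0.
Proof.
rewrite mem_lspan; split=> [[c ->]|->]; first by rewrite big_ord0.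
by exists (fun=> 0); rewrite big_ord0.
Qed.

Lemma mem_lspan_cons {N} (x : N) s v :
  v \in lspan (x :: s) <-> exists a, v - a *: x \in lspan s.
Proof.
rewrite mem_lspan; split=> [[c ->]|[a /mem_lspan[c Ec]]].
  exists (c ord0); apply/mem_lspan; exists (fun j => c (lift ord0 j)).
  by rewrite big_ord_recl /= addrC addKr.
exists (fun j => if unlift ord0 j is Some i then c i else a).
rewrite big_ord_recl unlift_none /=.
under eq_bigr => i _ do rewrite liftK.
by rewrite -Ec addrC subrK.
Qed.

Lemma lspan_mem {N} (s : seq N) x : x \in s -> x \in lspan s.
Proof.
elim: s => // y s IH; rewrite in_cons mem_lspan_cons => /predU1P[->|/IH xs].
  by exists 1; rewrite scale1r subrr rpred0.
by exists 0; rewrite scale0r subr0.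
Qed.

Lemma mem_lspan_cat {N} (s1 s2 : seq N) v :
  v \in lspan (s1 ++ s2) <-> exists2 u, u \in lspan s1 & v - u \in lspan s2.
Proof.
elim: s1 v => [|x s1 IH] v /=.
  split=> [vs|[u /mem_lspan_nil->]]; last by rewrite subr0.
  by exists 0; rewrite ?rpred0 ?subr0.
rewrite mem_lspan_cons; split.
  move=> [a /IH[u us1 us2]]; exists (u + a *: x).
    by apply/mem_lspan_cons; exists a; rewrite addrK.
  by rewrite opprD addrA addrAC.
move=> [u /mem_lspan_cons[a us1] us2]; exists a; apply/IH.
by exists (u - a *: x); rewrite // opprB addrA subrK.
Qed.

Lemma mem_lspan_map {U N} (f : {linear U -> N}) s v :
  v \in lspan (map f s) <-> exists2 u, u \in lspan s & v = f u.
Proof.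
elim: s v => [|x s IH] v /=.
  split=> [/mem_lspan_nil->|[u /mem_lspan_nil-> ->]].
    by exists 0; rewrite ?rpred0 ?linear0.
  by rewrite linear0 rpred0.
rewrite mem_lspan_cons; split.
  move=> [a /IH[u us vE]]; exists (u + a *: x).
    by apply/mem_lspan_cons; exists a; rewrite addrK.
  by rewrite linearD linearZ /= -vE subrK.
move=> [u /mem_lspan_cons[a us] ->]; exists a; apply/IH.
by exists (u - a *: x); rewrite // linearB [f (a *: x)]linearZ.
Qed.

Lemma lquot_pi_linear {N} (s : seq N) : linear (lquot_pi s).
Proof. by move=> a u v; rewrite lquot_piD -lquot_scale_pi. Qed.

HB.instance Definition _ {N} (s : seq N) :=
  GRing.isLinear.Build R N (lquot s) *:%R (lquot_pi s) (lquot_pi_linear s).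

Lemma lquot_pi_surj {N} (s : seq N) y : exists v, lquot_pi s v = y.
Proof. by exists (generic_quotient.repr y); apply: lquot_reprK. Qed.

Lemma lquot_pi_eq0 {N} (s : seq N) v : lquot_pi s v = 0 <-> v \in lspan s.
Proof. by rewrite -(linear0 (lquot_pi s)) lquot_piP subr0. Qed.

(** * Presentations of modules *)

Definition presents {U N} (g : {linear U -> N}) (Z : U -> Prop) :=
  (forall y, exists u, g u = y) /\ (forall u, g u = 0 <-> Z u).

Lemma presents_lquot {N} (s : seq N) :
  presents (lquot_pi s) (fun v => v \in lspan s).
Proof. by split; [apply: lquot_pi_surj | apply: lquot_pi_eq0]. Qed.

(** First isomorphism theorem: both modules are the quotient of U by the
submodule Z, so the map f u |-> f' u is well defined and bijective. *)
Lemma presents_iso {U N N'} {f : {linear U -> N}} {f' : {linear U -> N'}} {Z} :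
  presents f Z -> presents f' Z -> lmod_iso N N'.
Proof.
move=> [fS fK] [fS' fK'].
have [p pK] := choice fS; have [p' pK'] := choice fS'.
have eqf u v : f u = f v <-> f' u = f' v.
  split=> /eqP; rewrite -subr_eq0 -linearB => /eqP.
    by move/fK/fK'/eqP; rewrite linearB subr_eq0 => /eqP.
  by move/fK'/fK/eqP; rewrite linearB subr_eq0 => /eqP.
have lin : linear (f' \o p).
  move=> a u v /=; rewrite -linearZ -linearD; apply/eqf.
  by rewrite linearD linearZ !pK.
have [g gE] := linear_map_of lin.
exists g; exists (f \o p') => y; rewrite gE /=; last by rewrite -[RHS]pK'; apply/eqf.
by rewrite -[RHS]pK; apply/eqf.
Qed.

Lemma presents_comp {U N N'} {f : {linear U -> N}} {g : {linear N -> N'}} {Z Z'} :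
  presents f Z -> presents g Z' -> presents (g \o f) (fun u => Z' (f u)).
Proof.
move=> [fS fK] [gS gK]; split=> [y|u]; last exact: gK.
by have [x <-] := gS y; have [u <-] := fS x; exists u.
Qed.

Lemma lmod_iso_sym {N N'} : lmod_iso N N' -> lmod_iso N' N.
Proof.
move=> [f [g fK gK]]; have lg : linear g.
  by move=> a u v; apply: (can_inj fK); rewrite linearP !gK.
by have [h hE] := linear_map_of lg; exists h; exists f => x; rewrite hE.
Qed.

(** N is isomorphic to the direct sum of the R/(d j).  A presentation is used
instead of cyclic_sum because submatrices, concatenations and changes of single
entries are easy on families indexed by ordinals, and because generators of N
lift to rows of a matrix. *)
Definition diag_pres N {n} (d : 'I_n -> R) :=
  exists g : {linear 'rV[R]_n -> N},
    presents g (fun v => forall j, exists c, v 0 j = c * d j).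

Lemma diag_pres_iso {N N' n} {d : 'I_n -> R} :
  lmod_iso N N' -> diag_pres N d -> diag_pres N' d.
Proof.
move=> [f [f' fK fK']] [g [gS gK]]; exists (f \o g); split=> [y|u].
  by have [u Eu] := gS (f' y); exists u; rewrite /= Eu fK'.
by rewrite -gK /= -(linear0 f); split=> [/(can_inj fK)|->].
Qed.

Lemma iso_diag_pres {N N' n} {d : 'I_n -> R} :
  diag_pres N d -> diag_pres N' d -> lmod_iso N N'.
Proof. by move=> [g gP] [g' gP']; apply: presents_iso gP gP'. Qed.

Lemma eq_diag_pres {N n} (d d' : 'I_n -> R) :
  d =1 d' -> diag_pres N d -> diag_pres N d'.
Proof. by move=> /funext->. Qed.

Definition cat_fam {T : Type} {n1 n2} (d1 : 'I_n1 -> T) (d2 : 'I_n2 -> T)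
  (j : 'I_(n1 + n2)) : T :=
  match fintype.split j with inl i => d1 i | inr i => d2 i end.

Lemma cat_fam_lshift T n1 n2 (d1 : 'I_n1 -> T) (d2 : 'I_n2 -> T) i :
  cat_fam d1 d2 (lshift n2 i) = d1 i.
Proof. by rewrite /cat_fam (unsplitK (inl i)). Qed.

Lemma cat_fam_rshift T n1 n2 (d1 : 'I_n1 -> T) (d2 : 'I_n2 -> T) i :
  cat_fam d1 d2 (rshift n1 i) = d2 i.
Proof. by rewrite /cat_fam (unsplitK (inr i)). Qed.

(** A row vector of length n1 + n2 splits into its two halves, and the
divisibility conditions split accordingly. *)
Lemma diag_pres_prod {N1 N2 n1 n2} {d1 : 'I_n1 -> R} {d2 : 'I_n2 -> R} :
  diag_pres N1 d1 -> diag_pres N2 d2 ->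
  diag_pres (N1 * N2)%type (cat_fam d1 d2).
Proof.
move=> [g1 [gS1 gK1]] [g2 [gS2 gK2]].
pose f (v : 'rV[R]_(n1 + n2)) : (N1 * N2)%type :=
  (g1 (lsubmx v), g2 (rsubmx v)).
have lf : linear f.
  by move=> a u v; rewrite /f !linearP.
have [g gE] := linear_map_of lf; exists g; split=> [[y1 y2]|v]; rewrite ?gE.
  have [u1 <-] := gS1 y1; have [u2 <-] := gS2 y2.
  by exists (row_mx u1 u2); rewrite gE /f row_mxKl row_mxKr.
transitivity (g1 (lsubmx v) = 0 /\ g2 (rsubmx v) = 0).
  by split=> [[-> ->]|[]] //; rewrite /f => -> ->.
rewrite gK1 gK2; split.
  move=> [h1 h2] j; case: (fintype.splitP j) => i ji.
    have -> : j = lshift n2 i by exact: val_inj.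
    by have [c] := h1 i; rewrite mxE cat_fam_lshift; exists c.
  have -> : j = rshift n1 i by exact: val_inj.
  by have [c] := h2 i; rewrite mxE cat_fam_rshift; exists c.
move=> h; split=> i; rewrite mxE.
  by have [c] := h (lshift n2 i); rewrite cat_fam_lshift; exists c.
by have [c] := h (rshift n1 i); rewrite cat_fam_rshift; exists c.
Qed.

Lemma diag_pres_cyclic (x : R) :
  diag_pres (lquot [:: (x : R^o)]) (fun _ : 'I_1 => x).
Proof.
pose f (v : 'rV[R]_1) : lquot [:: (x : R^o)] := lquot_pi _ (v 0 0 : R^o).
have lf : linear f by move=> a u v; rewrite /f !mxE -linearP.
have [g gE] := linear_map_of lf; exists g; split=> [y|v]; rewrite ?gE.
  have [a <-] := lquot_pi_surj _ y.
  by exists (\row__ (a : R)); rewrite gE /f mxE.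
rewrite lquot_pi_eq0 mem_lspan_cons; split.
  move=> [a /mem_lspan_nil/eqP]; rewrite subr_eq0 => /eqP E j.
  by exists a; rewrite ord1 E.
move=> /(_ 0)[a E]; exists a; apply/mem_lspan_nil/eqP; rewrite subr_eq0.
by apply/eqP.
Qed.

Lemma diag_pres_cyclic_sum {n} (d : 'I_n -> R) :
  diag_pres (cyclic_sum [seq d j | j <- enum 'I_n]) d.
Proof.
elim: n d => [|n IH] d.
  rewrite (_ : enum 'I_0 = [::]) /=; last by apply: size0nil; rewrite size_enum_ord.
  have lf : linear (@id ('rV[R]_0)) by [].
  have [g gE] := linear_map_of lf.
  by exists g; split=> [y|u]; [exists y | split=> [_ []|]]; rewrite ?gE // thinmx0.
rewrite enum_ordSl /= -map_comp.
have := diag_pres_prod (diag_pres_cyclic (d ord0)) (IH (d \o lift ord0)).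
apply: eq_diag_pres => j; rewrite /cat_fam; case: (fintype.splitP j) => i ji.
  by congr d; apply: val_inj; rewrite (ord1 i) in ji; exact: (esym ji).
by congr d; apply: val_inj; exact: (esym ji).
Qed.

Lemma cyclic_sum_diag_pres {N} {xs : seq R} :
  lmod_iso N (cyclic_sum xs) -> diag_pres N (fun j : 'I_(size xs) => xs`_j).
Proof.
move=> /lmod_iso_sym Nxs; apply: (diag_pres_iso Nxs).
have := diag_pres_cyclic_sum (fun j : 'I_(size xs) => xs`_j).
suff -> : [seq xs`_j | j : 'I_(size xs) <- enum 'I_(size xs)] = xs by [].
by rewrite (map_comp (nth 0 xs) val) val_enum_ord -/(mkseq _ _) mkseq_nth.
Qed.

Lemma lspan_row {n k} (s : seq 'rV[R]_n) v : size s = k -> v \in lspan s ->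
  exists w : 'rV[R]_k, v = w *m \matrix_(l < k) s`_l.
Proof.
move=> <- /mem_lspan[c ->]; exists (\row_l c l).
by rewrite mulmx_sum_row; apply: eq_bigr => l _; rewrite mxE rowK.
Qed.

Lemma diag_multP {n} (d : 'I_n -> R) (v : 'rV[R]_n) :
  (forall j, exists c, v 0 j = c * d j) <->
  exists u, v = u *m diag_mx (\row_j d j).
Proof.
split=> [/choice[c vE]|[u ->] j]; last first.
  by exists (u 0 j); rewrite mul_mx_diag !mxE.
by exists (\row_j c j); apply/rowP => j; rewrite mul_mx_diag !mxE.
Qed.

(** Dividing by the generators indexed by S replaces the summand R/(d j) by
R/(1) = 0 for j in S; the tuple is padded with zeros to length k. *)
Lemma diag_pres_kill {N n k} {d : 'I_n -> R} {S : {set 'I_n}} :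
  diag_pres N d -> (#|S| <= k)%N ->
  exists x : k.-tuple N,
    diag_pres (lquot x) (fun j => if j \in S then 1 else d j).
Proof.
move=> [g [gS gK]] Sk.
pose y : seq 'rV[R]_n :=
  [seq delta_mx 0 j | j <- enum S] ++ nseq (k - #|S|) 0.
have ysz : size (map g y) == k.
  by rewrite size_map size_cat size_map size_nseq -cardE subnKC.
exists (Tuple ysz), (lquot_pi (Tuple ysz) \o g).
split; first exact: (presents_comp (conj gS gK) (presents_lquot _)).1.
move=> v /=; rewrite lquot_pi_eq0 /= mem_lspan_map; split.
  move=> [u /mem_lspan[c uE] /eqP]; rewrite -subr_eq0 -linearB => /eqP/gK vu j.
  case: ifPn => jS; first by exists (v 0 j); rewrite mulr1.
  (* u is in the span of the unit vectors in S, so it vanishes outside S *)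
  suff uj0 : u 0 j = 0 by have [a] := vu j; rewrite !mxE uj0 subr0; exists a.
  rewrite uE summxE big1 // => l _; rewrite mxE.
  have : y`_l \in y by exact: mem_nth.
  rewrite mem_cat => /orP[/mapP[i iS ->]|/nseqP[-> _]]; last by rewrite mxE mulr0.
  rewrite mxE eqxx; case: eqP => [ji|]; last by rewrite mulr0.
  by move: iS jS; rewrite mem_enum ji => ->.
move=> vd; pose u : 'rV[R]_n := \row_j (if j \in S then v 0 j else 0).
exists u.
  rewrite (row_sum_delta u) rpred_sum // => j _; rewrite mxE.
  case: ifPn => jS; last by rewrite scale0r rpred0.
  by rewrite rpredZ // lspan_mem // mem_cat map_f ?mem_enum.
apply/eqP; rewrite -subr_eq0 -linearB; apply/eqP/gK => j; rewrite !mxE.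
by case: ifP (vd j) => _; [exists 0; rewrite mul0r subrr | rewrite subr0].
Qed.

Lemma lquot_prod {N1 N2} (s1 : seq N1) (s2 : seq N2) :
  lmod_iso (lquot s1 * lquot s2)%type
    (lquot ([seq (a, 0) | a <- s1] ++ [seq (0, b) | b <- s2] : seq (N1 * N2)%type)).
Proof.
pose f (u : (N1 * N2)%type) : (lquot s1 * lquot s2)%type :=
  (lquot_pi s1 u.1, lquot_pi s2 u.2).
have lf : linear f by move=> a u v; rewrite /f /= !linearP.
have [g gE] := linear_map_of lf.
suff gP : presents g (fun u : (N1 * N2)%type =>
    u \in lspan ([seq (a, 0) | a <- s1] ++ [seq (0, b) | b <- s2])).
  exact: presents_iso gP (presents_lquot _).
split=> [[y1 y2]|u]; rewrite ?gE.
  have [u1 <-] := lquot_pi_surj _ y1; have [u2 <-] := lquot_pi_surj _ y2.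
  by exists (u1, u2); rewrite gE.
have lin1 : linear (fun a => (a, 0) : (N1 * N2)%type).
  by move=> a u1 v1; congr pair; rewrite /= scaler0 addr0.
have lin2 : linear (fun b => (0, b) : (N1 * N2)%type).
  by move=> a u1 v1; congr pair; rewrite /= scaler0 addr0.
have [i1 i1E] := linear_map_of lin1; have [i2 i2E] := linear_map_of lin2.
rewrite -(eq_map i1E) -(eq_map i2E) mem_lspan_cat.
transitivity (u.1 \in lspan s1 /\ u.2 \in lspan s2).
  by rewrite -!lquot_pi_eq0 /f; split=> [[-> ->]|[-> ->]].
split=> [[u1 u2]|[_ /mem_lspan_map[a as1 ->] /mem_lspan_map[b bs2]]].
  exists (i1 u.1); apply/mem_lspan_map; first by exists u.1.
  exists u.2 => //; rewrite i1E i2E; case: u {u1 u2} => u1 u2.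
  by congr pair; rewrite /= ?subrr ?subr0.
rewrite i1E i2E => /eqP; rewrite subr_eq => /eqP ->.
by rewrite /= addr0 add0r.
Qed.

End Span.

(** * Decomposition of finitely presented modules over a valuation ring *)

Section DiagExists.
Context {R : idomainType}.
Context (Rdvd : forall x y : R, (exists z, y = z * x) \/ (exists z, x = z * y)).

Lemma exists_common_divisor (s : seq R) : s != [::] ->
  exists2 p, p \in s & forall x, x \in s -> exists c, x = c * p.
Proof.
elim: s => // x [_ _|y s /(_ isT)[p ps pdiv] _].
  by exists x => [|y]; rewrite ?inE // => /eqP->; exists 1; rewrite mul1r.
have [[c xE]|[c pE]] := Rdvd p x.
  by exists p => [|z]; rewrite inE ?ps ?orbT // => /predU1P[->|/pdiv//]; exists c.
exists x => [|z]; rewrite inE ?eqxx // => /predU1P[->|/pdiv[a ->]].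
  by exists 1; rewrite mul1r.
by exists (a * c); rewrite pE mulrA.
Qed.

(** Smith normal form over a valuation ring, by induction on n.  Divisibility
is total, so some entry p_j0 of a relation p divides all entries of all
relations, and p = p_j0 q with q_j0 = 1.  The free module is the direct sum of
the line R q and of the coordinate hyperplane x_j0 = 0.  Reduction modulo q,
written tau, takes a relation v to v - v_j0 q, and v_j0 q is a multiple of p.
The relation module is thus the direct sum of R p = p_j0 R q and of its image
under tau, and the quotient is R/(p_j0) plus a module on n generators. *)
Lemma diag_pres_lquot {n} (s : seq 'rV[R]_n) :
  exists d : 'I_n -> R, diag_pres (lquot s) d.
Proof.
elim: n s => [|n IH] s.
  exists (fun=> 0), (lquot_pi s); split=> [y|u]; first exact: lquot_pi_surj.
  by rewrite (thinmx0 u) linear0; split=> // _ [].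
have [->|s0] := eqVneq s [::].
  exists (fun=> 0), (lquot_pi _); split=> [y|u]; first exact: lquot_pi_surj.
  rewrite lquot_pi_eq0 mem_lspan_nil; split=> [-> j|u0].
    by exists 0; rewrite mxE mul0r.
  by apply/rowP => j; have [c] := u0 j; rewrite mulr0 mxE.
pose entries := [seq (v : 'rV[R]_n.+1) 0 j | v <- s, j <- enum 'I_n.+1].
have entriesP v j : v \in s -> v 0 j \in entries.
  by move=> vs; apply/allpairsP; exists (v, j); rewrite mem_enum.
have [|_ /allpairsP[[p j0] [/= ps _ ->]] piv] := exists_common_divisor entries.
  case: s s0 @entries entriesP => // v s _ entries /(_ v ord0).
  by rewrite inE eqxx => /(_ isT); case: entries.
have /choice[q0 q0E] j : exists c, p 0 j = c * p 0 j0 by apply/piv/entriesP.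
(* entry j0 is set to 1 because p_j0 may be 0, and then q0 j0 is arbitrary *)
pose q : 'rV[R]_n.+1 := \row_j (if j == j0 then 1 else q0 j).
have qj0 : q 0 j0 = 1 by rewrite mxE eqxx.
have pE : p = p 0 j0 *: q.
  apply/rowP => j; rewrite !mxE mulrC; case: eqP => [->|_]; last exact: q0E.
  by rewrite mul1r.
have ltau : linear (fun v : 'rV[R]_n.+1 => col' j0 (v - v 0 j0 *: q)).
  by move=> a u v; apply/rowP => j; rewrite !mxE mulrBr mulrDl opprD addrACA mulrA.
have [tau tauE] := linear_map_of ltau.
have tau0 z : tau z = 0 -> z = z 0 j0 *: q.
  rewrite tauE => tz; apply/rowP => j; case: (unliftP j0 j) => [l ->|->].
    by move/rowP/(_ l): tz; rewrite !mxE => /eqP; rewrite subr_eq0 => /eqP.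
  by rewrite mxE qj0 mulr1.
have [d' dP] := IH (map tau s).
have := diag_pres_prod (diag_pres_cyclic (p 0 j0)) dP.
set d := cat_fam _ d' => dPd; exists d; apply: diag_pres_iso dPd.
pose f (v : 'rV[R]_n.+1) : (lquot [:: p 0 j0 : R^o] * lquot (map tau s))%type :=
  (lquot_pi _ (v 0 j0 : R^o), lquot_pi _ (tau v)).
have lf : linear f.
  move=> a u v; rewrite /f !mxE; congr pair; last by rewrite !linearP.
  exact: linearP.
have [g gE] := linear_map_of lf.
suff gP : presents g (fun v => v \in lspan s) by exact: presents_iso gP (presents_lquot s).
split=> [[y1 y2]|v]; rewrite ?gE.
  have [a <-] := lquot_pi_surj _ y1; have [b <-] := lquot_pi_surj _ y2.
  exists (a *: q + \row_l (if unlift j0 l is Some i then b 0 i else 0)).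
  rewrite gE /f; congr (lquot_pi _ _, lquot_pi _ _).
    by rewrite !mxE eqxx mulr1 unlift_none addr0.
  rewrite tauE; apply/rowP => l; rewrite !mxE eqxx mulr1 unlift_none addr0.
  by rewrite liftK addrC addKr.
transitivity ((v 0 j0 : R^o) \in lspan [:: p 0 j0 : R^o] /\
              tau v \in lspan (map tau s)).
  by rewrite -!lquot_pi_eq0 /f; split=> [[-> ->]|[-> ->]].
have dvdP (a : R^o) : a \in lspan [:: p 0 j0 : R^o] <-> exists c, a = c * p 0 j0.
  rewrite mem_lspan_cons; split=> -[c].
    by move=> /mem_lspan_nil/eqP; rewrite subr_eq0 => /eqP ->; exists c.
  by move=> ->; exists c; rewrite subrr rpred0.
have dvd_lspan u : u \in lspan s -> exists c, u 0 j0 = c * p 0 j0.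
  move=> /mem_lspan[c ->]; rewrite summxE.
  apply/dvdP/rpred_sum => l _; apply/dvdP; rewrite mxE.
  by have [|b ->] := piv (s`_l 0 j0); [apply/entriesP/mem_nth | exists (c l * b); rewrite mulrA].
rewrite dvdP mem_lspan_map; split=> [[[c vc] [u us vu]]|vs]; last first.
  by split; [apply: dvd_lspan | exists v].
have [b ub] := dvd_lspan u us.
rewrite -(subrK u v) rpredD //.
have /tau0 -> : tau (v - u) = 0 by rewrite linearB vu subrr.
by rewrite !mxE vc ub -mulrBl -scalerA -pE rpredZ // lspan_mem.
Qed.

Lemma fp_diag_pres {N : lmodType R} : finitely_presented N ->
  exists n (d : 'I_n -> R), diag_pres N d.
Proof.
move=> [n [s /lmod_iso_sym Ns]]; have [d dP] := diag_pres_lquot s.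
by exists n, d; apply: diag_pres_iso dP.
Qed.

End DiagExists.

(** * Determinants of relation matrices *)

(** Expansion of the determinant of a product of rectangular matrices, as in
the Cauchy-Binet formula, with a diagonal factor in the middle: row i of the
product is expanded over the choices f i of an intermediate index, and a map f
that takes a value twice contributes a matrix with two equal rows. *)
Lemma det_mul_diag_mul {R : comNzRingType} {n m} (A : 'M[R]_(n, m)) (c : 'rV[R]_m)
    (B : 'M[R]_(m, n)) :
  \det (A *m (diag_mx c *m B)) =
  \sum_(f : {ffun 'I_n -> 'I_m} | injectiveb f)
    (\prod_i c 0 (f i)) * ((\prod_i A i (f i)) * \det (rowsub f B)).
Proof.
rewrite /determinant.
pose T (s : {perm 'I_n}) i j := A i j * (c 0 j * B j (s i)).
transitivity (\sum_(f : {ffun 'I_n -> 'I_m})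
    \sum_(s : {perm 'I_n}) (-1) ^+ s * \prod_i T s i (f i)).
  rewrite exchange_big; apply: eq_bigr => /= s _; rewrite -big_distrr /=.
  congr (_ * _); rewrite -(bigA_distr_bigA (T s)) /=.
  apply: eq_bigr => i _; rewrite mxE; apply: eq_bigr => j _.
  by rewrite mul_diag_mx mxE.
have TE f : \sum_(s : {perm 'I_n}) (-1) ^+ s * \prod_i T s i (f i) =
    (\prod_i c 0 (f i)) * ((\prod_i A i (f i)) * \det (rowsub f B)).
  rewrite /determinant !big_distrr /=; apply: eq_bigr => s _.
  rewrite /T !big_split /=.
  have -> : \prod_i rowsub f B i (s i) = \prod_i B (f i) (s i).
    by apply: eq_bigr => i _; rewrite mxE.
  by rewrite [LHS]mulrCA [RHS]mulrCA; congr (_ * _); exact: mulrCA.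
rewrite (bigID (fun f : {ffun _} => injectiveb f)) /= [X in _ + X]big1 ?addr0.
  by apply: eq_bigr => f _; rewrite TE.
move=> f /injectivePn[i1 [i2 neq_i12 eq_f]]; rewrite TE.
rewrite (determinant_alternate neq_i12) ?mulr0 // => j.
by rewrite !mxE eq_f.
Qed.

(** Let g and h be families of n and m generators of a module, with h = B g and
g = C h.  The relations g - C h = 0 and e h = 0 form a block triangular matrix
of determinant the product of the e_j.  Substituting B g for h in them, a
unipotent column operation, makes the first n columns 1 - C B and e B, whose
rows are relations among the g alone.  If those are all generated by the rows
of diag d and X, this gives the factorization through a diagonal matrix. *)
Lemma det_relations {R : comNzRingType} {n m k} {d : 'rV[R]_n} {e : 'rV[R]_m}
    {X : 'M[R]_(k, n)} {B : 'M[R]_(m, n)} {C : 'M[R]_(n, m)} {Y Z} :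
  col_mx (1%:M - C *m B) (diag_mx e *m B) = Y *m diag_mx d + Z *m X ->
  \prod_j e 0 j =
  \det (row_mx (row_mx Y Z) (col_mx (- C) (diag_mx e)) *m
    (diag_mx (row_mx (row_mx d (const_mx 1)) (const_mx 1)) *m
     block_mx (col_mx 1%:M X) 0 0 1%:M)).
Proof.
move=> E.
transitivity (\det (block_mx 1%:M (- C) 0 (diag_mx e) *m
   block_mx 1%:M 0 B 1%:M)).
  by rewrite det_mulmx det_ublock det_lblock !det1 det_diag !mulr1 mul1r.
congr (\det _); rewrite !diag_mx_row !diag_const_mx.
rewrite !mulmx_block !mul_row_block !mulmx1 !mulmx0 !mul0mx ?mul1mx !addr0 !add0r.
rewrite [X in _ = row_mx (_ + X) _]mulmx0 [X in _ = row_mx _ (X + _)]mulmx0.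
rewrite mulmx1 addr0 add0r mul_block_col !mul0mx mulmx1 mul1mx addr0 add0r.
by rewrite mul_row_col -E block_mxEh mulNmx.
Qed.

(** Free modules are projective. *)
Lemma linear_lift {R : comNzRingType} {Q : lmodType R} {n m}
    (g : {linear 'rV[R]_n -> Q}) (h : {linear 'rV[R]_m -> Q}) :
  (forall y, exists u, g u = y) ->
  exists B : 'M[R]_(m, n), forall v, g (v *m B) = h v.
Proof.
move=> gS; have [u gu] := choice (fun i => gS (h (delta_mx 0 i))).
exists (\matrix_i u i) => v.
rewrite mulmx_sum_row {2}(row_sum_delta v) !linear_sum; apply: eq_bigr => i _.
by rewrite !linearZ rowK /= gu.
Qed.

(** * Valuations of relations *)

Section Valuation.
Context {K : realType} {R : idomainType} {val : R -> \bar K}.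
Context (hR : valuation_ring_height_one val).
Local Open Scope ereal_scope.

Let val_ge0 := val_ge0 hR.

Lemma val0 : val 0 = +oo.
Proof. exact/(val_eq_pinfty hR). Qed.

Lemma val1 : val 1 = 0.
Proof. by apply/(val_eq0 hR); apply: unitr1. Qed.

Lemma val_prod I (r : seq I) (P : pred I) (F : I -> R) :
  val (\prod_(i <- r | P i) F i)%R = \sum_(i <- r | P i) val (F i).
Proof. exact: (big_morph val (val_mul hR) val1). Qed.

(** The bound on v makes the empty sum, of value val 0 = +oo, no exception. *)
Lemma val_sum_gt I (r : seq I) (P : pred I) (F : I -> R) v :
  v < +oo -> (forall i, P i -> v < val (F i)) ->
  v < val (\sum_(i <- r | P i) F i)%R.
Proof.
move=> vy vF; apply: (big_ind (fun x => v < val x)) => //; first by rewrite val0.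
by move=> x y vx vy'; apply: lt_le_trans (val_add hR x y); rewrite lt_min vx.
Qed.

Lemma sum_val_ge0 I (r : seq I) (P : pred I) (F : I -> R) :
  0 <= \sum_(i <- r | P i) val (F i).
Proof. by apply: sume_ge0. Qed.

(** If diag e is a matrix of relations for some m generators of Q, and all
relations among some n generators are generated by the rows of diag d and by k
further rows X, then the product of the e_j is, by det_relations, a combination
of products of n + m entries, at distinct positions, of the diagonal
(d, 1, ..., 1) of length n + k + m.  Such a choice of positions omits only k of
them, hence at most k of the d_j.  By the ultrametric inequality one of the
products has valuation at most that of the product of the e_j. *)
Lemma diag_relations_val {Q : lmodType R} {n m k} (d : 'rV[R]_n) (e : 'rV[R]_m)
    (X : 'M[R]_(k, n)) (g : {linear 'rV[R]_n -> Q}) (h : {linear 'rV[R]_m -> Q}) :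
  (forall y, exists u, g u = y) -> (forall y, exists u, h u = y) ->
  (forall v, g v = 0%R -> exists u w, v = (u *m diag_mx d + w *m X)%R) ->
  (forall u, h (u *m diag_mx e) = 0%R) ->
  exists S : {set 'I_n}, (#|S| <= k)%N /\
    \sum_(j | j \notin S) val (d 0 j)%R <= \sum_j val (e 0 j)%R.
Proof.
move=> gS hS gK hK.
have [B gB] := linear_lift g h gS; have [C hC] := linear_lift h g hS.
pose G := col_mx (1%:M - C *m B) (diag_mx e *m B).
have gG (v : 'rV_(n + m)) : g (v *m G) = 0%R.
  rewrite -(hsubmxK v) mul_row_col linearD mulmxBr linearB !mulmxA !gB hC hK.
  by rewrite mulmx1 subrr addr0.
have [Y /choice[Z YZ]] := choice (fun i => gK _ (gG (row i 1%:M))).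
have GE : G = ((\matrix_i Y i) *m diag_mx d + (\matrix_i Z i) *m X)%R.
  apply/row_matrixP => i; rewrite linearD /= !row_mul !rowK -YZ.
  by rewrite -row_mul mul1mx.
have := det_relations GE; set c := row_mx _ (const_mx 1%R).
rewrite det_mul_diag_mul => /(congr1 val); rewrite val_prod.
set s := \sum_j _ => sE.
have [->|] := eqVneq s +oo; first by exists finset.set0; rewrite cards0 leey.
rewrite -ltey => sy.
(* otherwise all terms of the sum for the determinant have valuation above s *)
have [f finj fle] : exists2 f : {ffun 'I_(n + m) -> 'I_(n + k + m)},
    injectiveb f & \sum_i val (c 0%R (f i)) <= s.
  apply: contrapT => nf; move: (ltxx s).
  rewrite {2}sE val_sum_gt // => f finj; rewrite (val_mul hR) val_prod.
  apply: (@lt_le_trans _ _ (\sum_i val (c 0%R (f i)))); last by rewrite leeDl.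
  by rewrite ltNge; apply/negP => le; apply: nf; exists f.
pose up (i : 'I_n) : 'I_(n + k + m) := lshift m (lshift k i).
have up_inj : injective up by move=> i j /lshift_inj/lshift_inj.
have /injectiveP f_inj := finj.
exists [set i | up i \notin f @: [set: 'I_(n + m)]]%SET; split.
  rewrite -(card_imset _ up_inj).
  apply: (@leq_trans #|~: (f @: [set: 'I_(n + m)])|%SET).
    by apply/subset_leq_card/fintype.subsetP => _ /imsetP[i + ->]; rewrite !inE.
  rewrite cardsCs finset.setCK card_imset // cardsT !card_ord; lia.
apply: le_trans fle.
have -> : \sum_i val (c 0%R (f i)) =
    \sum_(x in f @: [set: 'I_(n + m)]%SET) val (c 0%R x).
  rewrite big_imset /=; last by move=> i j _ _; apply: f_inj.
  by apply: eq_bigl => i; rewrite inE.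
have -> : \sum_(j | j \notin [set i | up i \notin f @: [set: 'I_(n + m)]]%SET)
      val (d 0%R j) =
    \sum_(x in up @: [set i | up i \in f @: [set: 'I_(n + m)]%SET]%SET)
      val (c 0%R x).
  rewrite big_imset /=; last by move=> i j _ _; apply: up_inj.
  by apply: eq_big => i; rewrite ?inE ?negbK // /c /up !row_mxEl.
apply: lee_sum_nneg_subset => //.
by move=> _ /imsetP[i + ->]; rewrite !inE.
Qed.

End Valuation.

(** * Length and t-invariants *)

Section TInv.
Context {K : realType} {R : idomainType} {val : R -> \bar K}.
Context (hR : valuation_ring_height_one val).
Local Open Scope ereal_scope.
Implicit Types N : lmodType R.

(** The relations of N / (x) are generated by those of N and by lifts of the k
elements of x. *)
Lemma diag_quotient_val {N n m k} {d : 'I_n -> R} {x : k.-tuple N} {e : 'I_m -> R} :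
  diag_pres N d -> diag_pres (lquot x) e ->
  exists S : {set 'I_n}, (#|S| <= k)%N /\
    \sum_(j | j \notin S) val (d j) <= \sum_j val (e j).
Proof.
move=> [g gP] [h [hS hK]]; have [gS gK] := gP; have [p pK] := choice gS.
pose xs := map p x.
have xsz : size xs = k by rewrite size_map size_tuple.
have gxs : x = map g xs :> seq N.
  by rewrite -map_comp -[LHS]map_id; apply: eq_map => y /=; rewrite pK.
have [] := @diag_relations_val K R val hR _ n m k (\row_j d j)%R (\row_j e j)%R
  (\matrix_(l < k) xs`_l)%R (lquot_pi x \o g) h.
- exact: (presents_comp gP (presents_lquot _)).1.
- exact: hS.
- move=> v /lquot_pi_eq0; rewrite gxs => /mem_lspan_map[u us /eqP].
  rewrite -subr_eq0 -linearB => /eqP/gK/diag_multP[w vuE].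
  have [z uE] := lspan_row _ _ xsz us.
  by exists w, z; rewrite -vuE -uE subrK.
- by move=> u; apply/hK/diag_multP; exists u.
move=> S [Sk Sle]; exists S; split=> //.
move: Sle; under eq_bigr do rewrite mxE.
by under [leRHS]eq_bigr do rewrite mxE.
Qed.

(** Applied with k = 0, diag_quotient_val compares any two decompositions of N,
hence bounds the one selected in the definition of length. *)
Lemma length_diag_le {N n} {d : 'I_n -> R} :
  diag_pres N d -> length val N <= \sum_j val (d j).
Proof.
move=> dP; rewrite /length; case: xgetP => [l _ [xs [Nxs ->]]|nol]; last first.
  exfalso; apply: (nol (\sum_(x <- [seq d j | j <- enum 'I_n]) val x)).
  by exists [seq d j | j <- enum 'I_n]; split=> //; apply: iso_diag_pres dP (diag_pres_cyclic_sum d).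
have [g gP] := dP.
have [|S []] := @diag_quotient_val N _ n 0 (fun j : 'I_(size xs) => xs`_j) [tuple] d (cyclic_sum_diag_pres Nxs).
  exists (lquot_pi [::] \o g); split=> [|v /=].
    exact: (presents_comp gP (presents_lquot _)).1.
  by rewrite lquot_pi_eq0 mem_lspan_nil; apply: gP.2.
rewrite leqn0 cards_eq0 => /eqP->; rewrite (big_nth 0%R) big_mkord.
by under eq_bigl => j do rewrite inE.
Qed.

(** The value +oo covers modules without a cyclic decomposition; all other
values come from one, so finiteness of the length provides a decomposition. *)
Lemma length_cases N : length val N = +oo \/
  exists n (d : 'I_n -> R), diag_pres N d /\ length val N = \sum_j val (d j).
Proof.
rewrite /length; case: xgetP => [l _ [xs [Nxs ->]]|_]; [right|by left].
exists (size xs), (fun j => xs`_j); split; first exact: cyclic_sum_diag_pres.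
by rewrite (big_nth 0%R) big_mkord.
Qed.

Lemma length_ge0 N : 0 <= length val N.
Proof.
have [->|[n [d [_ ->]]]] := length_cases N; first exact: le0y.
exact: sum_val_ge0.
Qed.

Lemma t_inv_ge0 N k : 0 <= t_inv val N k.
Proof. by apply/ereal_infP => _ [x _ <-]; apply: length_ge0. Qed.

Lemma t_inv_le_sum {N n k} {d : 'I_n -> R} (S : {set 'I_n}) :
  diag_pres N d -> (#|S| <= k)%N ->
  t_inv val N k <= \sum_(j | j \notin S) val (d j).
Proof.
move=> dP Sk; have [x xP] := diag_pres_kill dP Sk.
apply: le_trans (ereal_inf_lbound _) _; first by exists x.
apply: le_trans (length_diag_le xP) _; rewrite [leRHS]big_mkcond /=.
apply: lee_sum => j _; case: ifP => // _; by rewrite val1.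
Qed.

Lemma length_lquot_ge {N n k} {d : 'I_n -> R} (x : k.-tuple N) : diag_pres N d ->
  exists S : {set 'I_n}, (#|S| <= k)%N /\
    \sum_(j | j \notin S) val (d j) <= length val (lquot x).
Proof.
move=> dP; have [->|[m [e [eP ->]]]] := length_cases (lquot x).
  by exists finset.set0; rewrite cards0 leey.
exact: diag_quotient_val dP eP.
Qed.

Lemma ge0_addey (x : \bar K) : 0 <= x -> x + +oo = +oo.
Proof. by case: x. Qed.

Lemma le_ereal_inf_add (X Y : set (\bar K)) t :
  (forall x, X x -> 0 <= x) -> (forall y, Y y -> 0 <= y) ->
  (forall x y, X x -> Y y -> t <= x + y) -> t <= ereal_inf X + ereal_inf Y.
Proof.
have le_inf_add (Z : set (\bar K)) s b : (forall z, Z z -> 0 <= z) -> 0 <= b ->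
    (forall z, Z z -> s <= z + b) -> s <= ereal_inf Z + b.
  move=> Z0; case: b => [b| |] b0 sb; last by rewrite leeNy_eq in b0.
    by rewrite -leeBlDr //; apply/ereal_infP => z /sb; rewrite leeBlDr.
  by rewrite ge0_addey ?leey //; apply/ereal_infP => z /Z0.
move=> X0 Y0 t_le; apply: (le_inf_add X) => //; first exact/ereal_infP.
move=> x Xx; rewrite addeC; apply: (le_inf_add Y) => //; first exact: X0.
by move=> y Yy; rewrite addeC t_le.
Qed.

(** Concatenating an i-tuple of N1 and a j-tuple of N2 gives a quotient of the
product whose length is the sum of the two lengths. *)
Lemma t_inv_prod_le N1 N2 i j :
  t_inv val (N1 * N2)%type (i + j) <= t_inv val N1 i + t_inv val N2 j.
Proof.
apply: le_ereal_inf_add => [_ [x _ <-]|_ [y _ <-]|_ _ [x _ <-] [y _ <-]];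
  try exact: length_ge0.
have [->|[n [d [dP ->]]]] := length_cases (lquot x).
  by rewrite addeC ge0_addey ?leey // length_ge0.
have [->|[m [e [eP ->]]]] := length_cases (lquot y).
  by rewrite ge0_addey ?leey // sum_val_ge0.
pose z : (i + j).-tuple (N1 * N2)%type :=
  cat_tuple (map_tuple (fun a => (a, 0%R)) x) (map_tuple (fun b => (0%R, b)) y).
apply: le_trans (ereal_inf_lbound _) _; first by exists z.
have zP := diag_pres_iso (lquot_prod _ _) (diag_pres_prod dP eP).
apply: le_trans (length_diag_le zP) _; rewrite big_split_ord /=.
by apply: leeD; apply: lee_sum => l _; rewrite ?cat_fam_lshift ?cat_fam_rshift.
Qed.

(** For every k-tuple x of the product, the length of the quotient is at least
the sum of the invariants outside a set S of at most k indices.  With i the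
number of indices of S in the first summand, that sum is at least
t_i(N1) + t_(k-i)(N2).  Since i depends on x, it is chosen among the finitely
many possibilities so as to minimize this bound. *)
Lemma t_inv_prod_ge {N1 N2} k :
  finitely_presented N1 -> finitely_presented N2 ->
  exists i j, (i + j = k)%N /\
    t_inv val N1 i + t_inv val N2 j <= t_inv val (N1 * N2)%type k.
Proof.
move=> /(fp_diag_pres (divides_total hR))[n1 [d1 P1]].
move=> /(fp_diag_pres (divides_total hR))[n2 [d2 P2]].
pose T (i : 'I_k.+1) := t_inv val N1 i + t_inv val N2 (k - i).
have [i _ imin] : exists2 i, true & forall j, true -> T i <= T j.
  by case: (@arg_minP _ _ _ ord0 predT T) => // i _ imin; exists i.
exists i, (k - i)%N; split; first by rewrite subnKC // -ltnS.
apply/ereal_infP => _ [x _ <-].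
have [S [Sk]] := length_lquot_ge x (diag_pres_prod P1 P2).
apply: le_trans; rewrite big_split_ord /=.
pose S1 := [set a | lshift n2 a \in S]%SET.
pose S2 := [set a | rshift n1 a \in S]%SET.
have cS : #|S| = (#|S1| + #|S2|)%N.
  rewrite -!sum1_card big_split_ord /=.
  by congr addn; apply: eq_bigl => a; rewrite inE.
have S1k : (#|S1| < k.+1)%N by lia.
apply: le_trans (imin (Ordinal S1k) isT) _; rewrite /T /=.
apply: leeD.
  apply: le_trans (t_inv_le_sum S1 P1 (leqnn _)) _.
  rewrite le_eqVlt; apply/orP; left; apply/eqP; apply: eq_big => a; first by rewrite inE.
  by rewrite cat_fam_lshift.
have S2k : (#|S2| <= k - #|S1|)%N by lia.
apply: le_trans (t_inv_le_sum S2 P2 S2k) _.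
rewrite le_eqVlt; apply/orP; left; apply/eqP; apply: eq_big => a; first by rewrite inE.
by rewrite cat_fam_rshift.
Qed.

End TInv.

(** * Convex hulls *)

Section Convex.
Context {K : realType}.
Implicit Types V W : lmodType K.

Definition convex_set {V} (C : set V) :=
  forall x y t, C x -> C y -> 0 <= t <= 1 -> C (t *: x + (1 - t) *: y).

(** Convexity is stated for two points.  For a combination of n points the
induction is on the normalized sum, since dropping a point leaves coefficients
whose sum is not 1. *)
Lemma conv_hull_sub {V} (X C : set V) :
  convex_set C -> X `<=` C -> conv_hull X `<=` C.
Proof.
move=> Cc XC _ [n [c [v [c0 c1 vX ->]]]].
suff H m (d : 'I_m -> K) (w : 'I_m -> V) : (forall j, 0 <= d j) ->
    (forall j, C (w j)) -> 0 < \sum_j d j ->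
    C ((\sum_j d j)^-1 *: \sum_j d j *: w j).
  have := H n c v c0 (fun j => XC _ (vX j)).
  by rewrite c1 invr1 scale1r; apply; rewrite ltr01.
elim: m d w => [|m IH] d w d0 wC; first by rewrite big_ord0 ltxx.
rewrite !big_ord_recr /=; set s := \sum_(_ < _) _; set l := d ord_max.
have s_ge0 : 0 <= s by apply: sumr_ge0.
have [s0|s_neq0 sl_gt0] := eqVneq s 0.
  rewrite s0 add0r big1 => [l_gt0|j _].
    by rewrite add0r scalerA mulVf ?scale1r ?gt_eqF.
  by rewrite (psumr_eq0P _ s0) ?scale0r // => i _; apply: d0.
have s_pos : 0 < s by rewrite lt_neqAle eq_sym s_neq0.
pose i_ := widen_ord (leqnSn m).
have := IH (fun j => d (i_ j)) (fun j => w (i_ j)) (fun j => d0 _) (fun j => wC _) s_pos.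
move=> Cs; have := Cc _ _ (s / (s + l)) Cs (wC ord_max).
rewrite scalerA -/s (_ : s / (s + l) / s = (s + l)^-1); last first.
  by rewrite mulrAC divff ?mul1r.
rewrite (_ : 1 - s / (s + l) = (s + l)^-1 * l); last first.
  by field; rewrite gt_eqF.
rewrite -scalerA -scalerDr; apply.
by rewrite divr_ge0 ?(ltW sl_gt0) //= ler_pdivrMr // mul1r lerDl d0.
Qed.

(** The two families of points are concatenated, with their coefficients
multiplied by t and 1 - t. *)
Lemma conv_hull_convex {V} (X : set V) : convex_set (conv_hull X).
Proof.
move=> _ _ t [n [c [v [c0 c1 vX ->]]]] [m [d [w [d0 d1 wX ->]]]] /andP[t0 t1].
exists (n + m)%N, (cat_fam (fun j => t * c j) (fun j => (1 - t) * d j)), (cat_fam v w).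
have cE j : cat_fam (fun j => t * c j) (fun j => (1 - t) * d j) (lshift m j) = t * c j.
  exact: cat_fam_lshift.
have dE j : cat_fam (fun j => t * c j) (fun j => (1 - t) * d j) (rshift n j) = (1 - t) * d j.
  exact: cat_fam_rshift.
split=> [j||j|].
- by rewrite /cat_fam; case: fintype.split => i; rewrite mulr_ge0 ?subr_ge0.
- rewrite big_split_ord /=; under eq_bigr do rewrite cE.
  under [X in _ + X]eq_bigr do rewrite dE.
  by rewrite -!mulr_sumr c1 d1 !mulr1 subrKC.
- by rewrite /cat_fam; case: fintype.split.
rewrite big_split_ord /= !scaler_sumr; congr (_ + _); apply: eq_bigr => j _.
  by rewrite cE cat_fam_lshift scalerA.
by rewrite dE cat_fam_rshift scalerA.
Qed.

Lemma conv_hull_id {V} (X : set V) : X `<=` conv_hull X.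
Proof.
move=> x Xx; exists 1%N, (fun=> 1), (fun=> x).
by split=> //; rewrite big_ord1 ?scale1r.
Qed.

Lemma conic_hull1 {V} (e x : V) :
  conic_hull [set e] x <-> exists2 c : K, 0 <= c & x = c *: e.
Proof.
split=> [[n [c [v [c0 vE ->]]]]|[c c0 ->]].
  exists (\sum_j c j); first exact: sumr_ge0.
  by rewrite scaler_suml; apply: eq_bigr => j _; rewrite vE.
by exists 1%N, (fun=> c), (fun=> e); split=> //; rewrite big_ord1.
Qed.

Lemma convex_preimage {V W} (f : V -> W) (C : set W) :
  (forall x y t, f (t *: x + (1 - t) *: y) = t *: f x + (1 - t) *: f y) ->
  convex_set C -> convex_set [set x | C (f x)].
Proof. by move=> fE Cc x y t Cx Cy t01 /=; rewrite fE; apply: Cc. Qed.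

Lemma convex_image {V W} (f : V -> W) (C : set V) :
  (forall x y t, f (t *: x + (1 - t) *: y) = t *: f x + (1 - t) *: f y) ->
  convex_set C -> convex_set (f @` C).
Proof.
move=> fE Cc _ _ t [x Cx <-] [y Cy <-] t01.
by exists (t *: x + (1 - t) *: y); [apply: Cc | apply: fE].
Qed.

Lemma convex_minkowski {V} (C D : set V) :
  convex_set C -> convex_set D -> convex_set (minkowski C D).
Proof.
move=> Cc Dc _ _ t [x Cx [y Dy <-]] [x' Cx' [y' Dy' <-]] t01.
exists (t *: x + (1 - t) *: x'); first exact: Cc.
exists (t *: y + (1 - t) *: y'); first exact: Dc.
by rewrite !scalerDr addrACA.
Qed.

(** A point of an open segment in the half-space l >= 0 lies on the hyperplane
l = 0 only if both end points do.  Combined with polyhedron_sub, this reduces a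
property Q of the face l = 0 of a polyhedron to the generators on that face. *)
Lemma convex_face {V} (l : V -> K) (Q : set V) :
  (forall x y t, l (t *: x + (1 - t) *: y) = t * l x + (1 - t) * l y) ->
  convex_set Q -> convex_set [set x | 0 <= l x /\ (l x = 0 -> Q x)].
Proof.
move=> lE Qc x y t [lx Qx] [ly Qy] t01 /=; have /andP[t0 t1] := t01.
have tx : 0 <= t * l x by rewrite mulr_ge0.
have ty : 0 <= (1 - t) * l y by rewrite mulr_ge0 ?subr_ge0.
split; first by rewrite lE addr_ge0.
rewrite lE => /eqP; rewrite paddr_eq0 // !mulf_eq0 subr_eq0.
have [->|_] := eqVneq t 0 => /=.
  by rewrite oner_eq0 /= => /eqP/Qy; rewrite scale0r add0r subr0 scale1r.
have [<-|_] := eqVneq 1 t => /=.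
  by rewrite andbT => /eqP/Qx; rewrite subrr scale0r addr0 scale1r.
by move=> /andP[/eqP/Qx Qx' /eqP/Qy Qy']; apply: Qc.
Qed.

End Convex.

(** * The polyhedron of a matroid *)

Section Polyhedron.
Context {K : realType} {R : idomainType} {val : R -> \bar K}.
Implicit Types E : finType.

(** The generator of the recession cone. *)
Definition upward E : ambient K E := (0, (0, 1)).

Lemma polyhedronP {E} (M : {set E} -> lmodType R) p : polyhedron val M p <->
  exists q, exists2 c, conv_hull [set p : ambient K E | exists (A : {set E}) (i : nat) (y : K),
       t_inv val (M A) i = y%:E /\ p = (indicator K A, (i%:R, y))] q &
     0 <= c /\ p = q + c *: upward E.
Proof.
split=> [[q Xq [u /conic_hull1[c c0 ->] <-]]|[q [c Xq [c0 ->]]]].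
  by exists q, c.
by exists q => //; exists (c *: upward E) => //; apply/conic_hull1; exists c.
Qed.

Lemma polyhedron_convex {E} (M : {set E} -> lmodType R) :
  convex_set (polyhedron val M).
Proof.
move=> _ _ t /polyhedronP[q [c Xq [c0 ->]]] /polyhedronP[q' [c' Xq' [c0' ->]]] t01.
apply/polyhedronP; exists (t *: q + (1 - t) *: q'), (t * c + (1 - t) * c').
  exact: conv_hull_convex.
case/andP: t01 => t0 t1.
split; first by rewrite addr_ge0 ?mulr_ge0 ?subr_ge0.
by rewrite !scalerDr !scalerA addrACA -scalerDl.
Qed.

Lemma polyhedron_gen {E} (M : {set E} -> lmodType R) A i y :
  t_inv val (M A) i = y%:E -> polyhedron val M (indicator K A, (i%:R, y)).
Proof.
move=> yE; apply/polyhedronP; exists (indicator K A, (i%:R, y)), 0.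
  by apply: conv_hull_id; exists A, i, y.
by rewrite scale0r addr0.
Qed.

Lemma polyhedron_up {E} (M : {set E} -> lmodType R) p c :
  0 <= c -> polyhedron val M p -> polyhedron val M (p + c *: upward E).
Proof.
move=> c0 /polyhedronP[q [b Xq [b0 ->]]]; apply/polyhedronP; exists q, (b + c) => //.
by split; [rewrite addr_ge0 | rewrite scalerDl addrA].
Qed.

(** The universal property through which all inclusions are proved. *)
Lemma polyhedron_sub {E} (M : {set E} -> lmodType R) (C : set (ambient K E)) :
  convex_set C -> (forall p c, 0 <= c -> C p -> C (p + c *: upward E)) ->
  (forall A i y, t_inv val (M A) i = y%:E -> C (indicator K A, (i%:R, y))) ->
  polyhedron val M `<=` C.
Proof.
move=> Cc Cup Cgen _ /polyhedronP[q [c Xq [c0 ->]]]; apply: Cup => //.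
by apply: conv_hull_sub Xq => // _ [A [i [y [yE ->]]]]; apply: Cgen.
Qed.

(** * Minors *)

Lemma omit_coord_linear E (a : E) : linear (@omit_coord K E a).
Proof.
by move=> t p q; congr pair; apply/ffunP => x; rewrite !ffunE.
Qed.

HB.instance Definition _ E (a : E) := GRing.isLinear.Build K (ambient K E)
  (ambient K {x : E | x != a}) *:%R (omit_coord a) (omit_coord_linear E a).

Lemma omit_coord_upward E (a : E) : omit_coord a (upward E) = upward _.
Proof. by congr pair; apply/ffunP => x; rewrite !ffunE. Qed.

(** Deletion is the case b = false and contraction the case b = true.  The
function l is the signed distance to the hyperplane x_a = b; it is nonnegative at all
generators of the polyhedron of M, and those with l = 0 come from the sets
obtained from the subsets of E minus a by adding a exactly when b holds. *)
Lemma polyhedron_minor {E} (M : {set E} -> lmodType R) (a : E) (b : bool)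
    (M' : {set {x : E | x != a}} -> lmodType R) :
  (forall A, M' A = M (\val @: A :|: if b then [set a] else finset.set0)%SET) ->
  polyhedron val M' =
    omit_coord a @` (polyhedron val M `&` [set p : ambient K E | p.1 a = b%:R]).
Proof.
pose ext (A : {set {x : E | x != a}}) :=
  (\val @: A :|: if b then [set a] else finset.set0)%SET.
move=> M'E.
pose l (p : ambient K E) : K := if b then 1 - p.1 a else p.1 a.
have l0 p : l p = 0 <-> p.1 a = b%:R.
  by rewrite /l; case: (b) => //; split=> [/eqP|->]; rewrite ?subrr // subr_eq0 => /eqP.
have lE (x y : ambient K E) t : l (t *: x + (1 - t) *: y) = t * l x + (1 - t) * l y.
  by rewrite /l; case: (b); rewrite !ffunE //= /GRing.scale /=; ring.
have l_up (p : ambient K E) c : l (p + c *: upward E) = l p.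
  by rewrite /l !ffunE /= scaler0 addr0.
have omitE x y t : omit_coord a (t *: x + (1 - t) *: y) =
    t *: omit_coord a x + (1 - t) *: omit_coord (K := K) a y.
  by rewrite linearD !linearZ.
have omit_up p c : omit_coord a (p + c *: upward E) =
    omit_coord (K := K) a p + c *: upward _.
  by rewrite linearD linearZ /= omit_coord_upward.
have omit_ind A i y :
    omit_coord a (indicator K A, (i, y)) =
    (indicator K (\val @^-1: A)%SET, (i, y)) :> ambient K {x : E | x != a}.
  by congr pair; apply/ffunP => x; rewrite !ffunE inE.
have a_ext A : (a \in ext A) = b.
  rewrite !inE; case: (b); rewrite ?inE ?eqxx ?orbT // orbF.
  by apply/imsetP => -[x _ ax]; have := valP x; rewrite -ax eqxx.
have extK A : (\val @^-1: (ext A))%SET = A.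
  apply/setP => x; rewrite !inE mem_imset; last exact: val_inj.
  by case: (b); rewrite ?inE ?(negPf (valP x)) orbF.
have preK (A : {set E}) : (a \in A) = b -> ext (\val @^-1: A)%SET = A.
  move=> aA; apply/setP => x; rewrite !inE; have [->|xa] := eqVneq x a.
    by rewrite aA -[RHS](a_ext (\val @^-1: A)%SET) !inE.
  pose x' : {x : E | x != a} := exist _ x xa.
  rewrite -[x]/(\val x') mem_imset; last exact: val_inj.
  by rewrite !inE; case: (b); rewrite ?inE /= ?(negPf xa) orbF.
rewrite eqEsubset; split.
  apply: polyhedron_sub => [|_ c c0 [p [Pp pa] <-]|A i y yE].
  - move=> _ _ t [p [Pp /l0 pa] <-] [q [Pq /l0 qa] <-] t01.
    exists (t *: p + (1 - t) *: q); last exact: omitE.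
    split; first exact: polyhedron_convex.
    by apply/l0; rewrite lE pa qa !mulr0 addr0.
  - exists (p + c *: upward E); last exact: omit_up.
    by split; [exact: polyhedron_up | apply/l0; rewrite l_up; apply/l0].
  exists (indicator K (ext A), (i%:R, y)); last by rewrite omit_ind extK.
  by split; [apply: polyhedron_gen; rewrite M'E in yE | rewrite /= ffunE a_ext].
move=> _ [p [Pp /l0 pa] <-].
suff [_ /(_ pa)] : [set p | 0 <= l p /\ (l p = 0 -> polyhedron val M' (omit_coord a p))] p by [].
apply: polyhedron_sub Pp => [|q c c0 [lq Pq]|A i y yE] /=.
- apply: (convex_face _ _ lE).
  by apply: (convex_preimage _ _ omitE); apply: polyhedron_convex.
- by rewrite l_up omit_up; split=> // /Pq; apply: polyhedron_up.
split.
  by rewrite /l ffunE; case: (b); case: (a \in A); rewrite ?subrr ?subr0 // ler01.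
move=> /l0 /=; rewrite ffunE => /eqP; rewrite eqr_nat => /eqP aA.
rewrite omit_ind; apply: polyhedron_gen; rewrite M'E -/(ext _) preK //.
by case: (a \in A) (b) aA => [] [].
Qed.

(** * Duality *)

(** The affine map sends the generator of M at (A, i) to the generator of Md at
the complement of A and the index |A| - r + i, with the same t-invariant.  The
indices that occur are natural numbers on both sides because t_invz is +oo at
negative integers. *)
Lemma polyhedron_dual {E} (M Md : {set E} -> lmodType R) :
  is_dual val M Md ->
  polyhedron val Md = dual_map (generic_rank M) @` polyhedron val M.
Proof.
move=> [_ Mdual]; set r := generic_rank M in Mdual *.
have dualE (x y : ambient K E) t : dual_map r (t *: x + (1 - t) *: y) =
    t *: dual_map r x + (1 - t) *: dual_map r y.
  congr pair; first by apply/ffunP => a; rewrite !ffunE /= /GRing.scale /=; ring.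
  congr pair; rewrite /= /GRing.scale /=.
  under eq_bigr do rewrite !ffunE.
  by rewrite big_split /= -!scaler_sumr /GRing.scale /=; ring.
have dual_up (p : ambient K E) c :
    dual_map r (p + c *: upward E) = dual_map r p + c *: upward E.
  congr pair.
    by apply/ffunP => a; rewrite !ffunE /= scaler0 addr0 addr0.
  by congr pair; rewrite /= !scaler0 !addr0.
have dual_ind (A : {set E}) (i j : nat) (y : K) : j%:Z = #|A|%:Z - r%:Z + i%:Z ->
    dual_map r (indicator K A, (i%:R, y)) = (indicator K (~: A)%SET, (j%:R, y)).
  move=> ijE; congr pair.
    by apply/ffunP => a; rewrite !ffunE inE; case: (a \in A); rewrite ?subrr ?subr0.
  congr pair; rewrite /= (_ : \sum_a _ = #|A|%:R).
    by rewrite -[RHS]/((j%:Z)%:~R) ijE rmorphD rmorphB.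
  under eq_bigr do rewrite ffunE.
  by rewrite -natr_sum -sum1_card [in RHS]big_mkcond.
rewrite eqEsubset; split.
  apply: polyhedron_sub => [|_ c c0 [p Pp <-]|B j y yE].
  - by apply: (convex_image _ _ dualE); apply: polyhedron_convex.
  - by exists (p + c *: upward E); [exact: polyhedron_up | exact: dual_up].
  pose z := j%:Z - #|(~: B)%SET|%:Z + r%:Z.
  have jE : #|(~: B)%SET|%:Z - r%:Z + z = j%:Z by rewrite /z; ring.
  have := Mdual (~: B)%SET z; rewrite finset.setCK jE /= yE.
  case: z jE => [i|//] jE /= ME.
  exists (indicator K (~: B)%SET, (i%:R, y)); first exact: polyhedron_gen.
  by rewrite (dual_ind _ _ j) ?finset.setCK.
move=> _ [p Pp <-]; move: p Pp.
apply: (polyhedron_sub _ [set p | polyhedron val Md (dual_map r p)]).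
- by apply: (convex_preimage _ _ dualE); apply: polyhedron_convex.
- by move=> p c c0 /= ?; rewrite dual_up; apply: polyhedron_up.
move=> A i y yE /=; have := Mdual A i%:Z; rewrite /= yE.
case jE: (_ - _ + _) => [j|//] /= /esym MdE.
by rewrite (dual_ind _ _ j) //; apply: polyhedron_gen.
Qed.

(** * Direct sums *)

Lemma incl1_linear {E1} E2 : linear (@incl1 K E1 E2).
Proof.
move=> t p q; congr pair; apply/ffunP => -[x|x]; rewrite !ffunE //.
by rewrite scaler0 addr0.
Qed.

Lemma incl2_linear E1 {E2} : linear (@incl2 K E1 E2).
Proof.
move=> t p q; congr pair; apply/ffunP => -[x|x]; rewrite !ffunE //.
by rewrite scaler0 addr0.
Qed.

Lemma adde_le_fin {a b : \bar K} {y : K} :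
  (0 <= a -> 0 <= b -> a + b <= y%:E ->
   exists y1 y2, [/\ a = y1%:E, b = y2%:E & (y1 + y2 <= y)%R])%E.
Proof.
case: a b => [a| |] [b| |] a0 b0 //; rewrite ?leeNy_eq // in a0 b0.
by move=> ab; exists a, b.
Qed.

(** By t_inv_prod_ge, each generator of the direct sum lies above a sum of
generators of the two factors; by t_inv_prod_le, each sum of generators lies
above a generator of the direct sum.  In the second case, polyhedron_sub is
applied to each factor in turn, the other point being fixed. *)
Lemma polyhedron_direct_sum {E1 E2 : finType} (M1 : {set E1} -> lmodType R)
    (M2 : {set E2} -> lmodType R) : valuation_ring_height_one val ->
  (forall A, finitely_presented (M1 A)) -> (forall A, finitely_presented (M2 A)) ->
  polyhedron val (direct_sum M1 M2) =
    minkowski (incl1 E2 @` polyhedron val M1) (incl2 E1 @` polyhedron val M2).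
Proof.
move=> hR fp1 fp2.
have [i1 i1E] := linear_map_of (@incl1_linear E1 E2).
have [i2 i2E] := linear_map_of (@incl2_linear E1 E2).
have -> : incl1 E2 = i1 by apply/funext => p; rewrite i1E.
have -> : incl2 E1 = i2 by apply/funext => p; rewrite i2E.
have lin (V W : lmodType K) (f : {linear V -> W}) x y (t : K) :
    f (t *: x + (1 - t) *: y) = t *: f x + (1 - t) *: f y.
  by rewrite linearD !linearZ.
have i1_up : i1 (upward E1) = upward _.
  by rewrite i1E; congr pair; apply/ffunP => -[x|x]; rewrite !ffunE.
have i2_up : i2 (upward E2) = upward _.
  by rewrite i2E; congr pair; apply/ffunP => -[x|x]; rewrite !ffunE.
have i_ind (A : {set E1 + E2}) k1 k2 (y1 y2 : K) :
    i1 (indicator K (inl @^-1: A)%SET, (k1, y1)) +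
    i2 (indicator K (inr @^-1: A)%SET, (k2, y2)) =
    (indicator K A, (k1 + k2, y1 + y2)) :> ambient K (E1 + E2)%type.
  rewrite i1E i2E; congr pair; apply/ffunP => -[x|x].
    by rewrite !ffunE addr0 inE.
  by rewrite !ffunE add0r inE.
have ind_up E (A : {set E}) (k y c : K) :
    (indicator K A, (k, y + c)) = (indicator K A, (k, y)) + c *: upward E :> ambient K E.
  congr pair; first by apply/ffunP => a; rewrite !ffunE scaler0 addr0.
  by congr pair; rewrite /= /GRing.scale /= ?mulr0 ?addr0 ?mulr1.
rewrite eqEsubset; split.
  apply: polyhedron_sub => [|_ c c0 [_ [p Pp <-] [_ [q Pq <-] <-]]|A k y yE].
  - by apply: convex_minkowski; apply: (convex_image _ _ (lin _ _ _)); apply: polyhedron_convex.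
  - exists (i1 (p + c *: upward E1)).
      by exists (p + c *: upward E1) => //; apply: polyhedron_up.
    exists (i2 q); first by exists q.
    by rewrite linearD linearZ /= i1_up addrAC.
  have [k1 [k2 [kE]]] := t_inv_prod_ge hR k (fp1 (inl @^-1: A)%SET) (fp2 (inr @^-1: A)%SET).
  rewrite -[X in (_ <= X)%E]/(t_inv val (direct_sum M1 M2 A) k) yE.
  have := t_inv_ge0 hR (M1 (inl @^-1: A)%SET) k1.
  have := t_inv_ge0 hR (M2 (inr @^-1: A)%SET) k2.
  move=> t2_ge0 t1_ge0 /(adde_le_fin t1_ge0 t2_ge0)[y1 [y2 [y1E y2E y12]]].
  pose c := y - (y1 + y2).
  have c0 : 0 <= c by rewrite subr_ge0.
  pose p : ambient K E1 := (indicator K (inl @^-1: A)%SET, (k1%:R, y1)).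
  exists (i1 (p + c *: upward E1)).
    exists (p + c *: upward E1) => //.
    by apply: polyhedron_up => //; apply: polyhedron_gen.
  exists (i2 (indicator K (inr @^-1: A)%SET, (k2%:R, y2))).
    by exists (indicator K (inr @^-1: A)%SET, (k2%:R, y2)) => //; apply: polyhedron_gen.
  rewrite linearD linearZ /= i1_up addrAC i_ind -ind_up -natrD kE.
  by congr (_, (_, _)); rewrite /c subrKC.
move=> _ [_ [p Pp <-] [_ [q Pq <-] <-]]; move: p Pp q Pq.
pose P := polyhedron val (direct_sum M1 M2).
apply: (polyhedron_sub _ [set p | forall q, polyhedron val M2 q -> P (i1 p + i2 q)]).
- move=> p p' t Pp Pp' t01 q Pq; rewrite lin.
  rewrite (_ : _ + _ = t *: (i1 p + i2 q) + (1 - t) *: (i1 p' + i2 q)).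
    by apply: polyhedron_convex => //; [apply: Pp | apply: Pp'].
  by rewrite !scalerDr addrACA -scalerDl subrKC scale1r.
- move=> p c c0 Pp q Pq; rewrite linearD linearZ /= i1_up addrAC.
  by apply: polyhedron_up => //; apply: Pp.
move=> A1 k1 y1 y1E.
apply: (polyhedron_sub _ [set q | P (i1 _ + i2 q)]).
- move=> q q' t Pq Pq' t01 /=; rewrite lin; set p := i1 _.
  rewrite (_ : _ + _ = t *: (p + i2 q) + (1 - t) *: (p + i2 q')).
    exact: polyhedron_convex.
  by rewrite !scalerDr addrACA -scalerDl subrKC scale1r.
- move=> q c c0 Pq; rewrite /= linearD linearZ /= i2_up addrA.
  exact: polyhedron_up.
move=> A2 k2 y2 y2E /=.
pose A := (inl @: A1 :|: inr @: A2)%SET : {set E1 + E2}.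
have A1E : (inl @^-1: A)%SET = A1.
  apply/setP => x; rewrite !inE mem_imset; last by move=> ? ? [].
  by rewrite (_ : _ \in inr @: A2 = false) ?orbF //; apply/imsetP => -[].
have A2E : (inr @^-1: A)%SET = A2.
  apply/setP => x; rewrite !inE orbC mem_imset; last by move=> ? ? [].
  by rewrite (_ : _ \in inl @: A1 = false) ?orbF //; apply/imsetP => -[].
rewrite -{1}A1E -{1}A2E i_ind -natrD.
have : (t_inv val (direct_sum M1 M2 A) (k1 + k2) <= y1%:E + y2%:E)%E.
  by rewrite -y1E -y2E -A1E -A2E; apply: (t_inv_prod_le hR).
have := t_inv_ge0 hR (direct_sum M1 M2 A) (k1 + k2).
case yE : (t_inv val (direct_sum M1 M2 A) (k1 + k2)) => [y| |] // _.
rewrite -EFinD lee_fin => yle.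
rewrite -(subrKC y (y1 + y2)) ind_up; apply: polyhedron_up; first by rewrite subr_ge0.
exact: polyhedron_gen.
Qed.

End Polyhedron.

(** * Compatibility with minors, duality and direct sums *)

Theorem proposition5p7 (K : realType) (R : idomainType) (val : R -> \bar K)
    (hR : valuation_ring_height_one val) :
  (forall (E : finType) (M : {set E} -> lmodType R) (a : E),
     matroid_over M ->
     polyhedron val (deletion M a) =
       omit_coord a @` (polyhedron val M `&` [set p : ambient K E | p.1 a = 0]) /\
     polyhedron val (contraction M a) =
       omit_coord a @` (polyhedron val M `&` [set p : ambient K E | p.1 a = 1])) /\
  (forall (E : finType) (M Md : {set E} -> lmodType R),
     matroid_over M -> is_dual val M Md ->
     polyhedron val Md = dual_map (generic_rank M) @` polyhedron val M) /\
  (forall (E1 E2 : finType) (M1 : {set E1} -> lmodType R)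
     (M2 : {set E2} -> lmodType R),
     matroid_over M1 -> matroid_over M2 ->
     polyhedron val (direct_sum M1 M2) =
       minkowski (incl1 E2 @` polyhedron val M1)
                 (incl2 E1 @` polyhedron val M2)).
Proof.
split; last split.
- move=> E M a _; split.
    by apply: (polyhedron_minor M a false) => A; rewrite finset.setU0.
  exact: (polyhedron_minor M a true).
- by move=> E M Md _; apply: polyhedron_dual.
by move=> E1 E2 M1 M2 [fp1 _] [fp2 _]; apply: polyhedron_direct_sum.
Qed.
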